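(* Let $\Gamma$ be a metrically homogeneous graph of generic type and diameter $\delta$. Let $i,k$ be positive integers with $k\le i$ and $i+k\le\delta$. Then $\Gamma$ contains a triangle of type $(i,i,2k)$.
   Context: A connected graph $\Gamma$ is viewed as a metric space under its path metric $d$. It is a metrically homogeneous graph if every isometry between finite subspaces of $\Gamma$ extends to an isometry of $\Gamma$ onto itself. Its diameter $\delta$ may be infinite. $\Gamma_1$ denotes the set of neighbors of a fixed basepoint, with the induced metric. $\Gamma$ is of generic type if any two vertices at distance $2$ have infinitely many common neighbors, among which there is an infinite independent set, and $\Gamma_1$ admits no non-trivial $\mathrm{Aut}(\Gamma_1)$-invariant equivalence relation (i.e. none other than equality and the universal relation). A triangle of type $(i,j,k)$ is a triple of vertices whose pairwise distances are $i,j,k$. *)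

(* Defs.v *)
From mathcomp Require Import all_boot.
From mathcomp Require Import boolp classical_sets functions cardinality.

Set Implicit Arguments.
Unset Strict Implicit.
Unset Printing Implicit Defensive.

Local Open Scope classical_set_scope.

Section MetricSpaces.

Definition isometry (T U : Type) (dT : T -> T -> nat) (dU : U -> U -> nat)
    (f : T -> U) : Prop :=
  bijective f /\ forall x y, dU (f x) (f y) = dT x y.

Definition induced (T : Type) (d : T -> T -> nat) (A : set T) : A -> A -> nat :=
  fun a b => d (val a) (val b).

(* The value None stands for an infinite diameter. *)
Definition has_diameter (T : Type) (d : T -> T -> nat) (delta : option nat)
    : Prop :=
  if delta is Some D then
    (forall x y, d x y <= D) /\ exists x y, d x y = D
  else forall n, exists x y, n < d x y.

Definition le_diameter (n : nat) (delta : option nat) : Prop :=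
  if delta is Some D then n <= D else True.

Definition contains_triangle (T : Type) (d : T -> T -> nat) (i j k : nat)
    : Prop :=
  exists x y z, [/\ d x y = i, d x z = j & d y z = k].

End MetricSpaces.

Section Graphs.

(* The vertex set is an arbitrary type, possibly infinite. *)
Variables (V : Type) (e : rel V).

Definition simple_graph : Prop := symmetric e /\ irreflexive e.

Definition walk_of_length (x y : V) (n : nat) : Prop :=
  exists p : seq V, [/\ path e x p, last x p = y & size p = n].

Definition connected_graph : Prop := forall x y, exists n, walk_of_length x y n.

Definition is_distance (x y : V) (n : nat) : Prop :=
  walk_of_length x y n /\ forall m, walk_of_length x y m -> n <= m.

(* The default value 0 is only reached between distinct components. *)
Definition gdist (x y : V) : nat := xget 0 [set n | is_distance x y n].

Lemma gdistP : connected_graph -> forall x y, is_distance x y (gdist x y).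
Proof.
move=> conn x y; apply: (@xgetPex _ 0 [set n | is_distance x y n]).
have exW : exists n, `[< walk_of_length x y n >].
  by have [n Wn] := conn x y; exists n; apply/asboolP.
case: (ex_minnP exW) => n /asboolP Wn min_n.
by exists n; split=> // m Wm; apply: min_n; apply/asboolP.
Qed.

Definition metrically_homogeneous : Prop :=
  forall (A B : set V) (f : A -> B),
    finite_set A -> finite_set B ->
    isometry (induced gdist (A := A)) (induced gdist (A := B)) f ->
  exists g : V -> V,
    isometry gdist gdist g /\ forall a : A, g (val a) = val (f a).

Definition neighbors (x : V) : set V := [set y | e x y].

(* Automorphisms of A are its self-isometries for the metric induced from the
   whole graph, not for the path metric of the subgraph on A. *)
Definition automorphism_invariant (A : set V) (R : rel A) : Prop :=
  forall g : A -> A,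
    isometry (induced gdist (A := A)) (induced gdist (A := A)) g ->
  forall u w, R (g u) (g w) = R u w.

Definition primitive (A : set V) : Prop :=
  forall R : rel A, equivalence_rel R -> automorphism_invariant R ->
    (forall u w, R u w <-> u = w) \/ (forall u w, R u w).

Definition independent_set (I : set V) : Prop :=
  forall x y, I x -> I y -> ~~ e x y.

Definition generic_type (v0 : V) : Prop :=
  (forall x y, gdist x y = 2 ->
     infinite_set (neighbors x `&` neighbors y) /\
     exists I : set V, [/\ I `<=` neighbors x `&` neighbors y,
                           infinite_set I & independent_set I])
  /\ primitive (neighbors v0).

End Graphs.

(* Main.v *)
Require Import Defs.
From mathcomp Require Import all_boot.
From mathcomp Require Import zify.
From mathcomp Require Import boolp classical_sets cardinality.

Set Implicit Arguments.
Unset Strict Implicit.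
Unset Printing Implicit Defensive.

(** Fix a vertex q and two others s, x.  Each of s and x splits the neighbors of q
into those nearer to it than q is, those as near, and those farther; write E_s,
D_s, F_s for the three classes determined by s.  The triangle (i, i, 2k) is
reached through the triangles with d q s = i - j, d q x = i + j, d s x = 2k,
for j = k, ..., 0.  For j = k this is a geodesic of length i + k.  To go from
(a, c) to (a + 1, c - 1), where a + 2 <= c, one may either replace q by a neighbor
lying in F_s and in E_x, or find the new triangle from scratch.  What works
depends on the graph induced on the spheres of radius a + 1.

If that sphere contains an induced path with three vertices, then any two of its
points at distance 2 have a common neighbor in the sphere.  The sphere is linked
by steps of length at most 2 ([linked_realized]), so the distance to a given
point takes every intermediate value on it ([interpolation]), and [spread]
provides points on both sides of the value 2k.

If that sphere contains no edge and the graph has no triangle of type (1, 1, 1),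
then q can be moved ([exchange_step]).  Otherwise E_x is disjoint from F_s, and an
independent sphere forces E_x to lie inside E_t, where t extends a geodesic from
q to s by one step.  For points t1 between q and x on the sphere of t one gets
E_t1 inside E_x inside E_t; exchanging t and t1 by homogeneity gives equality,
so E_t1 does not depend on t1.  This contradicts [level_separation]: the classes
of two points at distance 2 in a sphere differ, since otherwise linking would make
them constant on the sphere.

The remaining possibility is that the sphere induces a disjoint union of cliques.
If the graph has triangles, primitivity of the neighborhood of a vertex excludes
this and also excludes an independent sphere ([level_path]), so interpolation
applies at once with j = 0.  If it has none, the cliques would form a perfect
matching, which [no_perfect_matching] rules out by [level_separation] again. *)

(** * Spheres in homogeneous integral metric spaces *)

Section HomogeneousGeodesicSpace.

Variables (V : Type) (d : V -> V -> nat).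

Hypothesis d_refl : forall x, d x x = 0.
Hypothesis d_eq0 : forall x y, d x y = 0 -> x = y.
Hypothesis d_sym : forall x y, d x y = d y x.
Hypothesis d_tri : forall x y z, d x z <= d x y + d y z.
Hypothesis d_between : forall x y a b,
  d x y = a + b -> exists z, d x z = a /\ d z y = b.
Hypothesis d_hom : forall n (x y : 'I_n -> V),
  (forall i j, d (x i) (x j) = d (y i) (y j)) ->
  exists g : V -> V,
    (forall u v, d (g u) (g v) = d u v) /\ forall i, g (x i) = y i.
Hypothesis d_generic : forall x y, d x y = 2 ->
  exists s t, [/\ d x s = 1, d s y = 1, d x t = 1, d t y = 1 & d s t = 2].

Local Ltac tri x y z :=
  move: (d_tri x y z) (d_tri y z x) (d_tri z x y)
        (d_sym x y) (d_sym y z) (d_sym x z).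

Lemma hom4 x1 x2 x3 x4 y1 y2 y3 y4 :
    d x1 x2 = d y1 y2 -> d x1 x3 = d y1 y3 -> d x1 x4 = d y1 y4 ->
    d x2 x3 = d y2 y3 -> d x2 x4 = d y2 y4 -> d x3 x4 = d y3 y4 ->
  exists g, (forall u v, d (g u) (g v) = d u v) /\
    [/\ g x1 = y1, g x2 = y2, g x3 = y3 & g x4 = y4].
Proof.
move=> d12 d13 d14 d23 d24 d34.
pose x (i : 'I_4) := nth x1 [:: x1; x2; x3; x4] i.
pose y (i : 'I_4) := nth y1 [:: y1; y2; y3; y4] i.
have [|g [isog gx]] := @d_hom _ x y.
  move=> [[|[|[|[|//]]]] ?] [[|[|[|[|//]]]] ?]; rewrite /x /y /= ?d_refl //;
    by rewrite d_sym [in RHS]d_sym.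
exists g; split=> //.
by split; [have := gx (inord 0) | have := gx (inord 1) |
  have := gx (inord 2) | have := gx (inord 3)]; rewrite /x /y inordK.
Qed.

Lemma hom3 x1 x2 x3 y1 y2 y3 :
    d x1 x2 = d y1 y2 -> d x1 x3 = d y1 y3 -> d x2 x3 = d y2 y3 ->
  exists g, (forall u v, d (g u) (g v) = d u v) /\
    [/\ g x1 = y1, g x2 = y2 & g x3 = y3].
Proof.
move=> d12 d13 d23.
have [||||||g [isog [g1 g2 g3 _]]] // := @hom4 x1 x2 x3 x3 y1 y2 y3 y3.
  by rewrite !d_refl.
by exists g.
Qed.

Lemma hom2 x1 x2 y1 y2 : d x1 x2 = d y1 y2 ->
  exists g, [/\ forall u v, d (g u) (g v) = d u v, g x1 = y1 & g x2 = y2].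
Proof.
move=> d12; have [|||g [isog [g1 g2 _]]] // := @hom3 x1 x2 x2 y1 y2 y2.
  by rewrite !d_refl.
by exists g.
Qed.

(** When d is a path metric this says that n is at most the diameter. *)
Definition realized n := exists x y, d x y = n.

Lemma realizedW m n : m <= n -> realized n -> realized m.
Proof.
move=> le_mn [x [y dxy]].
have [|z [dxz _]] := @d_between x y m (n - m); first by lia.
by exists x, z.
Qed.

Lemma extend n q x : realized n -> d q x <= n ->
  exists y, d q y = n /\ d x y = n - d q x.
Proof.
move=> [a [b dab]] le_n.
have [|c [dac dcb]] := @d_between a b (d q x) (n - d q x); first by lia.
have [g [isog ga gc]] := hom2 dac.
by exists (g b); rewrite -ga -gc !isog; rewrite dac.
Qed.

(** All common neighbors of x and of a point two steps nearer to q lie on the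
same sphere about q, and two of them are at distance 2. *)
Lemma lower_pair m q x : d q x = m.+2 -> exists s t,
  [/\ d q s = m.+1, d q t = m.+1, d s x = 1, d t x = 1 & d s t = 2].
Proof.
move=> dqx; have [|u [dqu dux]] := @d_between q x m 2; first by lia.
have [s [t [us sx ut tx st]]] := d_generic dux.
exists s, t; split=> //.
  by tri q u s; tri q s x; lia.
by tri q u t; tri q t x; lia.
Qed.

Lemma upper_pair m q u : realized m.+2 -> d q u = m -> exists s t,
  [/\ d q s = m.+1, d q t = m.+1, d u s = 1, d u t = 1 & d s t = 2].
Proof.
move=> Rm dqu; have [|x [dqx dux]] := @extend m.+2 q u Rm; first by lia.
have {}dux : d u x = 2 by lia.
have [s [t [us sx ut tx st]]] := d_generic dux.
exists s, t; split=> //.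
  by tri q u s; tri q s x; lia.
by tri q u t; tri q t x; lia.
Qed.

(** Pairs at distance 2 in a sphere about q form a single orbit under the
stabilizer of q, so the pair given by [lower_pair] is typical. *)
Lemma common_upper m q s t : realized m.+2 ->
    d q s = m.+1 -> d q t = m.+1 -> d s t = 2 ->
  exists x, [/\ d q x = m.+2, d s x = 1 & d t x = 1].
Proof.
move=> Rm dqs dqt dst.
have [|x [dqx _]] := @extend m.+2 q q Rm; first by rewrite d_refl.
have [s' [t' [dqs' dqt' sx tx st]]] := lower_pair dqx.
have [|||g [isog [gq gs gt]]] := @hom3 q s' t' q s t; try lia.
by exists (g x); rewrite -gs -gt -{1}gq !isog.
Qed.

Lemma common_lower m q s t : realized m.+2 ->
    d q s = m.+1 -> d q t = m.+1 -> d s t = 2 ->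
  exists u, [/\ d q u = m, d s u = 1 & d t u = 1].
Proof.
move=> Rm dqs dqt dst.
have [|u [dqu _]] := @extend m q q (realizedW (leqW (leqnSn m)) Rm).
  by rewrite d_refl.
have [s' [t' [dqs' dqt' us ut st]]] := upper_pair Rm dqu.
have [|||g [isog [gq gs gt]]] := @hom3 q s' t' q s t; try lia.
exists (g u); split; first by rewrite -gq isog.
  by rewrite -gs isog d_sym.
by rewrite -gt isog d_sym.
Qed.

(** * Linking the points of a sphere *)

Definition triangles := contains_triangle d 1 1 1.

(** Connectedness of the spheres of radius m by steps of the lengths that occur
between neighbors of a vertex, phrased through the sets closed under these
steps so that no chain has to be built. *)
Definition linked m := forall q (P : V -> Prop),
  (forall a b, d q a = m -> d q b = m ->
     d a b = 2 \/ d a b = 1 /\ triangles -> P a -> P b) ->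
  forall a b, d q a = m -> d q b = m -> P a -> P b.

(** This is what primitivity of the neighborhoods contributes. *)
Hypothesis d_path : triangles -> realized 2 -> exists v x y z,
  [/\ d v x = 1, d v y = 1 & d v z = 1] /\ [/\ d x y = 1, d y z = 1 & d x z = 2].

Lemma common_neighbor_induced v a b : triangles ->
    d v a = 1 -> d v b = 1 -> d a b = 2 ->
  exists c, [/\ d v c = 1, d a c = 1 & d b c = 1].
Proof.
move=> tr va vb ab.
have [|v0 [x [y [z [[vx vy vz] [xy yz xz]]]]]] := d_path tr.
  by exists a, b.
have [|||g [isog [gv gx gz]]] := @hom3 v0 x z v a b; try lia.
exists (g y); rewrite -gv -gx -gz !isog; split=> //.
by rewrite d_sym.
Qed.

Lemma near_cases v a b : d v a = 1 -> d v b = 1 ->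
  [\/ a = b, d a b = 2 | d a b = 1 /\ triangles].
Proof.
move=> va vb; case dab: (d a b) => [|[|[|n]]].
- by apply: Or31; apply: d_eq0.
- by apply: Or33; split=> //; exists v, a, b.
- exact: Or32.
- by move: dab; tri v a b; lia.
Qed.

(** Let x be an upper neighbor of s that is not adjacent to t.  A common neighbor h
of s, t and x does the job if it lies above s.  Otherwise s has the same
position relative to h as to t, and x is a common upper neighbor of s and h. *)
Lemma common_upper_adjacent m q s t : triangles -> realized m.+1 ->
    d q s = m -> d q t = m -> d s t = 1 ->
  exists x, [/\ d q x = m.+1, d s x = 1 & d t x = 1].
Proof.
move=> tr Rm dqs dqt dst.
have [|x [dqx dsx]] := @extend m.+1 q s Rm; first by lia.
have {}dsx : d s x = 1 by lia.
have [xt|xt|[xt _]] := near_cases dsx dst.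
- by move: dqt; rewrite -xt dqx; lia.
- have [h [sh xh th]] := common_neighbor_induced tr dsx dst xt.
  have [dqh|dqh] : d q h = m.+1 \/ d q h = m by tri q s h; tri q x h; lia.
    by exists h; split.
  have [|||g [isog [gq gs gh]]] := @hom3 q s h q s t; try lia.
  exists (g x); split; first by rewrite -{1}gq isog.
    by rewrite -{1}gs isog.
  by rewrite -gh isog d_sym.
- by exists x; split=> //; rewrite d_sym.
Qed.

(** Chains on the sphere below lift: consecutive points there have a common upper
neighbor, and two upper neighbors of one point are one step apart. *)
Lemma linked_realized m : realized m.+1 -> linked m.+1.
Proof.
elim: m => [|m IHm] Rm q P Pstep a b qa qb Pa.
  by have [<- //|ab|ab] := near_cases qa qb; apply: (Pstep a); tauto.
have Pnear u s t : d q s = m.+2 -> d q t = m.+2 -> d u s = 1 -> d u t = 1 ->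
    P s -> P t.
  move=> qs qt us ut.
  by have [<- //|st|st] := near_cases us ut; apply: Pstep; tauto.
(* The set of points below all of whose upper neighbors satisfy P is closed. *)
have {}IHm := IHm (realizedW (leqnSn _) Rm) q
  (fun w => forall x, d q x = m.+2 -> d w x = 1 -> P x).
have [|u [qu ua]] := @d_between q a m.+1 1; first by lia.
have [|v [qv vb]] := @d_between q b m.+1 1; first by lia.
apply: (IHm _ u v) => // [s t qs qt st Ps x qx tx | x qx ux].
  have [y [qy sy ty]] :
      exists y, [/\ d q y = m.+2, d s y = 1 & d t y = 1].
    case: st => [st|[st tr]]; first exact: common_upper.
    exact: common_upper_adjacent.
  by apply: (Pnear t y) => //; apply: Ps.
exact: (Pnear u a).
Qed.

(** The path s, v, t makes every step of length 2 on the sphere factor through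
another point of the sphere, so the distance to x changes by at most 1 at a time
along a chain from a to b. *)
Lemma interpolation m q v s t x a b l : realized m.+2 ->
    d q v = m.+1 -> d q s = m.+1 -> d q t = m.+1 ->
    d v s = 1 -> d v t = 1 -> d s t = 2 ->
    d q a = m.+1 -> d q b = m.+1 -> d x a <= l -> l <= d x b ->
  exists c, d q c = m.+1 /\ d x c = l.
Proof.
move=> Rm qv qs qt vs vt st qa qb xa xb; apply: contrapT => no_c.
have neq_l c : d q c = m.+1 -> d x c <> l by move=> qc xc; apply: no_c; exists c.
have Pstep c e : d q c = m.+1 -> d q e = m.+1 -> d c e = 1 ->
    d x c < l -> d x e < l.
  by move=> qc qe ce; have := neq_l _ qe; tri x c e; lia.
have := @linked_realized m (realizedW (leqnSn _) Rm) q (fun c => d x c < l) _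
  a b qa qb.
have ltxa : d x a < l by have := neq_l _ qa; lia.
have nltxb : ~ d x b < l by lia.
move=> link; apply: nltxb; apply: link ltxa => c e qc qe [ce|[ce _]] lt_c;
  last exact: (Pstep c).
have [|||g [isog [gq gs gt]]] := @hom3 q s t q c e; try lia.
have qgv : d q (g v) = m.+1 by rewrite -gq isog.
apply: (Pstep (g v)) => //; first by rewrite -gt isog.
by apply: (Pstep c) => //; rewrite -gs isog d_sym.
Qed.

(** Suppose the neighbors of v on its own sphere about q form a clique D.  No
neighbor E of v below is adjacent to a neighbor F above, so D separates E from F
in the neighborhood H of v.  If g lies in F and c, c' in E, the vertices of H
adjacent to g and to c or c' lie in D, hence are pairwise adjacent.  By homogeneity
this holds for all g, c, c' in H with g not adjacent to c or c', as soon as E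
contains pairs of the same kind as (c, c').  Then the neighbors in H of any vertex
form a clique, against [d_path].  The only kind of pair that E can miss is that of
the edges; but if E is independent, the neighbors in H of a point of E lie in D and
again form a clique. *)
Lemma level_path m : triangles -> realized m.+3 -> exists q v x y,
  [/\ d q v = m.+2, d q x = m.+2 & d q y = m.+2] /\
  [/\ d v x = 1, d v y = 1 & d x y = 2].
Proof.
move=> tr Rm; apply: contrapT => no_path.
have clique q v x y : d q v = m.+2 -> d q x = m.+2 -> d q y = m.+2 ->
    d v x = 1 -> d v y = 1 -> d x y <= 1.
  move=> qv qx qy vx vy; rewrite leqNgt; apply/negP => gt1.
  apply: no_path; exists q, v, x, y; split; split=> //.
  by move: gt1; tri v x y; lia.
have R2 : realized 2 by apply: realizedW Rm.
have [v0 [x0 [y0 [z0 [[vx vy vz] [xy yz xz]]]]]] := d_path tr R2.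
have yx : d y0 x0 = 1 by rewrite d_sym.
have [q [_ _]] := Rm.
have [|v [qv _]] := @extend m.+2 q q (realizedW (leqnSn _) Rm).
  by rewrite d_refl.
have [f [qf vf]] : exists f, d q f = m.+3 /\ d v f = 1.
  by have [|f [qf vf]] := @extend m.+3 q v Rm; [|exists f; split]; lia.
have [e [e' [qe qe' ev e'v ee']]] := lower_pair qv.
have ve : d v e = 1 by rewrite d_sym.
pose lower_edge := exists a b,
  [/\ d v a = 1, d v b = 1, d q a = m.+1, d q b = m.+1 & d a b = 1].
have neighbors_clique w g c c' x x' : d w g = 1 -> d w c = 1 -> d w c' = 1 ->
    d w x = 1 -> d w x' = 1 -> d g c = 2 -> d g c' = 2 ->
    d g x = 1 -> d g x' = 1 -> d c x = 1 -> d c' x' = 1 ->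
    lower_edge -> d x x' <= 1.
  move=> wg wc wc' wx wx' gc gc' gx gx' cx cx' E1.
  have [a [b [va vb qa qb ab]]] : exists a b,
      [/\ d v a = 1, d v b = 1, d q a = m.+1, d q b = m.+1 & d a b = d c c'].
    have [cc'|cc'|[cc' _]] := near_cases wc wc'.
    - by exists e, e; rewrite cc' !d_refl.
    - by exists e, e'; rewrite cc'; split=> //; rewrite d_sym.
    - by rewrite cc'; apply: E1.
  have fa : d f a = 2 by tri f v a; tri q a f; lia.
  have fb : d f b = 2 by tri f v b; tri q b f; lia.
  have [||||||h [isoh [hw hg hc hc']]] := @hom4 w g c c' v f a b; try lia.
  have fhx : d f (h x) = 1 by rewrite -hg isoh.
  have fhx' : d f (h x') = 1 by rewrite -hg isoh.
  have ahx : d a (h x) = 1 by rewrite -hc isoh.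
  have bhx' : d b (h x') = 1 by rewrite -hc' isoh.
  rewrite -isoh; apply: (clique q v) => //; try by rewrite -hw isoh.
    by tri q f (h x); tri q a (h x); lia.
  by tri q f (h x'); tri q b (h x'); lia.
have [E1|E1] := EM lower_edge.
  suff: d x0 z0 <= 1 by lia.
  have far x : d v0 x = 1 -> d y0 x = 1 ->
      exists c, [/\ d v0 c = 1, d y0 c = 2 & d c x = 1].
    move=> v0x y0x.
    have [|||h [isoh [hv hy hx]]] := @hom3 v0 x0 y0 v0 y0 x; try lia.
    by exists (h z0); rewrite -{1}hv -{1}hy -hx !isoh; split=> //; rewrite d_sym.
  have [c [v0c y0c cx]] := far x0 vx yx.
  have [c' [v0c' y0c' cx']] := far z0 vz yz.
  exact: (neighbors_clique v0 y0 c c').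
have [|h [isoh hv hy]] := @hom2 v0 y0 v e; first by lia.
suff: d (h x0) (h z0) <= 1 by rewrite isoh; lia.
have onD x : d v0 x = 1 -> d y0 x = 1 -> d q (h x) = m.+2 /\ d v (h x) = 1.
  move=> v0x y0x.
  have vhx : d v (h x) = 1 by rewrite -hv isoh.
  have ehx : d e (h x) = 1 by rewrite -hy isoh.
  split=> //.
  have : d q (h x) <> m.+1 by move=> qhx; apply: E1; exists e, (h x).
  by tri q e (h x); tri q v (h x); lia.
have [qx vhx] := onD _ vx yx; have [qz vhz] := onD _ vz yz.
exact: (clique q v).
Qed.

(** * Spheres in triangle-free spaces *)

(** Were the class of the neighbors of q at distance l from s contained in that of
t, it would be the same for all points of the sphere, as these are linked by steps
of length 2; a nonempty class would then contain every neighbor of q, by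
homogeneity.  But q has neighbors both nearer to s and farther from s. *)
Lemma level_separation m q s t l : ~ triangles -> realized m.+2 ->
    d q s = m.+1 -> d q t = m.+1 -> d s t = 2 ->
    (forall x, d q x = 1 -> d x s = l -> d x t = l) ->
  ~ exists2 x, d q x = 1 & d x s = l.
Proof.
move=> ntr Rm qs qt st sub_st [x0 qx0 x0s].
have sub a b x : d q a = m.+1 -> d q b = m.+1 -> d a b = 2 -> d q x = 1 ->
    d x a = l -> d x b = l.
  move=> qa qb ab qx xa.
  have [|||g [isog [gq ga gb]]] := @hom3 q a b q s t; try lia.
  rewrite -isog gb; apply: sub_st; first by rewrite -gq isog.
  by rewrite -ga isog.
have const0 b : d q b = m.+1 -> d x0 b = l.
  move=> qb; apply: (@linked_realized m (realizedW (leqnSn _) Rm) q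
    (fun b => d x0 b = l) _ s b) => // a c qa qc [ac|[_ /ntr//]].
  exact: sub.
have const x : d q x = 1 -> d x s = l.
  move=> qx; have [|g [isog gq gx]] := @hom2 q x q x0; first by lia.
  by rewrite -isog gx; apply: const0; rewrite -gq isog.
have [|x [qx xs]] := @d_between q s 1 m; first by lia.
have [|y [sy qy]] := @extend m.+2 s q Rm; first by rewrite d_sym; lia.
have := const x qx; have := const y; rewrite [d y s]d_sym d_sym in qy *.
by move: (d_sym q s) (d_sym q y); lia.
Qed.

(** No edge has an equidistant point at distance a + 1, so a neighbor of q at distance
at most a + 1 from a point t with d q t = a + 1 is nearer to t than q is.  If no e
existed, then applying this to a point t beyond s would place the neighbors of q
that are nearer to x among those nearer to t. *)
Lemma exchange_step a c q s x : ~ triangles ->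
    (forall p u v, d p u = a.+1 -> d p v = a.+1 -> d u v <> 1) ->
    d q s = a -> d q x = c.+1 -> a < c ->
  exists e, [/\ d q e = 1, d e s = a.+1 & d e x = c].
Proof.
move=> ntr indep qs qx lt_ac; apply: contrapT => no_e.
have Rc : realized c.+1 by exists q, x.
have Ra : realized a.+2 by apply: realizedW Rc; lia.
have [|t [qt st]] := @extend a.+1 q s (realizedW (leqnSn _) Ra); first by lia.
have toward_t e : d q e = 1 -> d e x = c -> d e t = a.
  move=> qe ex; have es : d e s <> a.+1 by move=> es; apply: no_e; exists e.
  have : d e t <> a.+1.
    by move=> et; apply: (indep t q e); rewrite ?[d t _]d_sym.
  by tri q e s; tri e s t; tri q e t; lia.
have [|w [qw wx]] := @d_between q x a.+2 (c.+1 - a.+2); first by lia.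
(* Since w lies between q and x, so do its lower neighbors t1 and t2. *)
have [t1 [t2 [qt1 qt2 t1w t2w t12]]] := lower_pair qw.
have to_t u e : d q u = a.+1 -> d u w = 1 -> d q e = 1 -> d e u = a ->
    d e t = a.
  move=> qu uw qe eu; apply: toward_t => //.
  by tri e u w; tri e w x; tri q e x; lia.
have from_t u e : d q u = a.+1 -> d u w = 1 -> d q e = 1 -> d e t = a ->
    d e u = a.
  move=> qu uw qe et.
  have [|||g [isog [gq gt gu]]] := @hom3 q t u q u t; try lia.
    by rewrite d_sym.
  rewrite -isog gu; apply: (to_t u) => //; first by rewrite -gq isog.
  by rewrite -gt isog.
apply: (level_separation ntr Ra qt1 qt2 t12 (l := a)).
  by move=> e qe et1; apply: from_t => //; apply: (to_t t1).
have [|e [qe et1]] := @d_between q t1 1 a; first by lia.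
by exists e.
Qed.

(** Put M = m + 1.  For M = 1 an edge in a sphere gives a triangle.  Otherwise, if there
is an edge in a sphere of radius M, then by homogeneity each v with d v y = M has
exactly one neighbor at distance M from y, its partner t for y.  Let y' be another
point with d v y' = M, and d y y' = 2.  By [level_separation] t is not at distance M
from y', and by homogeneity d t y' is always M + 1 or always M - 1.  Choose a common
neighbor b of y and y' at distance M - 1 from v in the first case, M + 1 in the
second.  Then the neighbors of b at distance M from v turn out to be determined by b
and t, whereas two points at distance 2 are both placed like v relative to b and t,
against [level_separation]. *)
Lemma no_perfect_matching m : ~ triangles -> realized m.+3 ->
    (forall q v x y, d q v = m.+1 -> d q x = m.+1 -> d q y = m.+1 ->
       d v x = 1 -> d v y = 1 -> x = y) ->
  forall q v t, d q v = m.+1 -> d q t = m.+1 -> d v t <> 1.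
Proof.
move=> ntr Rm uniq q0 v0 t0 qv0 qt0 vt0.
case: m => [|m] in Rm uniq qv0 qt0.
  by apply: ntr; exists q0, v0, t0.
have twin v y : d v y = m.+2 -> exists t, d v t = 1 /\ d t y = m.+2.
  move=> vy; have [|g [isog gv gy]] := @hom2 v0 q0 v y.
    by rewrite d_sym; lia.
  exists (g t0); rewrite -gv -gy !isog; split=> //.
  by rewrite d_sym.
have {}uniq v y t t' : d v y = m.+2 -> d v t = 1 -> d v t' = 1 ->
    d t y = m.+2 -> d t' y = m.+2 -> t = t'.
  by move=> vy vt vt' ty t'y; apply: (uniq y v) => //; rewrite d_sym.
have R1 : realized m.+3 by apply: realizedW Rm; lia.
have twin_far v y y' t : d v y = m.+2 -> d v y' = m.+2 -> d y y' = 2 ->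
    d v t = 1 -> d t y = m.+2 -> d t y' <> m.+2.
  move=> vy vy' yy' vt ty ty'.
  apply: (level_separation ntr R1 vy vy' yy' (l := m.+2)); last by exists t.
  by move=> x vx xy; rewrite (uniq v y x t).
have sign v y y' t u z z' r : d v y = m.+2 -> d v y' = m.+2 -> d y y' = 2 ->
    d v t = 1 -> d t y = m.+2 ->
    d u z = m.+2 -> d u z' = m.+2 -> d z z' = 2 ->
    d u r = 1 -> d r z = m.+2 -> d r z' = d t y'.
  move=> vy vy' yy' vt ty uz uz' zz' ur rz.
  have [|||g [isog [gv gy gy']]] := @hom3 v y y' u z z'; try lia.
  rewrite -gy' (uniq u z r (g t)) ?isog //; first by rewrite -gv isog.
  by rewrite -gy isog.
have nbrs v a b : d v a = 1 -> d v b = 1 -> a = b \/ d a b = 2.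
  by move=> va vb; have [|| [_ /ntr]] := near_cases va vb; auto.
have [|w [qw _]] := @extend m.+3 q0 q0 R1; first by rewrite d_refl.
have [y [y' [qy qy' _ _ yy']]] := lower_pair qw.
have [t [qt ty]] := twin _ _ qy.
have ty' : d t y' = m.+3 \/ d t y' = m.+1.
  by have := twin_far _ _ _ _ qy qy' yy' qt ty; tri q0 t y'; lia.
have twin_level b : d y b = 1 -> d t b = m.+2 -> forall u v c z, d v u = 1 ->
    d u c = d q0 b -> d v c = m.+2 -> d c z = 1 -> d z v = m.+2 -> d u z = m.+2.
  move=> yb tb u v c z vu uc vc cz zv.
  have [|||g [isog [gt gq gb]]] := @hom3 t q0 b v u c; try by lia.
    by rewrite d_sym; lia.
  rewrite (uniq c v z (g y)) //.
  - by rewrite -gq isog.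
  - by rewrite d_sym.
  - by rewrite -gb isog d_sym.
  - by rewrite -gt isog d_sym.
(* In both cases t is on the sphere of radius m + 2 about b, z is the partner of b
   for t, and v, v2 are neighbors of t at distance 2.  The neighbors x of b at
   distance m + 2 from v are z and those for which d t x is the constant given by
   sign; this description does not involve v. *)
case: ty' => ty'.
- have [b [qb yb y'b]] := common_lower R1 qy qy' yy'.
  have tb : d t b = m.+2 by tri q0 t b; tri t b y'; lia.
  have bt : d b t = m.+2 by rewrite d_sym.
  have [v [v2 [bv bv2 vt v2t vv2]]] := lower_pair bt.
  have [z [bz zt]] := twin _ _ bt.
  have vz u : d b u = m.+1 -> d u t = 1 -> d u z = m.+2.
    move=> bu ut; apply: (twin_level b yb tb u t b) => //; first by rewrite d_sym.
    by rewrite d_sym bu qb.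
  apply: (level_separation ntr (realizedW (leqnSn _) R1) bv bv2 vv2
    (l := m.+2)); last by exists z; rewrite // d_sym vz.
  move=> x bx xv; have [<-|zx] := nbrs _ _ _ bz bx.
    by rewrite d_sym vz.
  have vx : d v x = m.+2 by rewrite d_sym.
  have tz : d t z = m.+2 by rewrite d_sym.
  have := sign _ _ _ _ _ _ _ _ qy qy' yy' qt ty (vz _ bv vt) vx zx vt tz.
  by tri t x v2; tri b x v2; lia.
- have [b [qb yb y'b]] := common_upper R1 qy qy' yy'.
  have tb : d t b = m.+2 by tri q0 t b; tri t b y'; lia.
  have bt : d b t = m.+2 by rewrite d_sym.
  have [v [v2 [bv bv2 tv tv2 vv2]]] := upper_pair Rm bt.
  have [z [bz zt]] := twin _ _ bt.
  have vz u : d b u = m.+3 -> d t u = 1 -> d u z = m.+2.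
    move=> bu tu; apply: (twin_level b yb tb u t b) => //.
    by rewrite d_sym bu qb.
  apply: (level_separation ntr Rm bv bv2 vv2 (l := m.+2));
    last by exists z; rewrite // d_sym vz.
  move=> x bx xv; have [<-|zx] := nbrs _ _ _ bz bx.
    by rewrite d_sym vz.
  have vx : d v x = m.+2 by rewrite d_sym.
  have tz : d t z = m.+2 by rewrite d_sym.
  have vt : d v t = 1 by rewrite d_sym.
  have := sign _ _ _ _ _ _ _ _ qy qy' yy' qt ty (vz _ bv tv) vx zx vt tz.
  by tri t x v2; tri b x v2; lia.
Qed.

(** * Isosceles triangles *)

(** For b, extend the geodesic from x to q by k - j steps, up to distance i + k from
x, and then the geodesic from q to its end w by i - k more steps. *)
Lemma spread i j k : realized (i + k) -> k <= i -> j <= k ->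
  exists q x a b, [/\ d q x = i + j, d q a = i - j & d q b = i - j] /\
    d x a <= 2 * k /\ 2 * k <= d x b.
Proof.
move=> R ki jk.
have [|x [q xq]] := @realizedW (i + j) _ _ R; first by lia.
have [|a [xa aq]] := @d_between x q (2 * j) (i - j); first by lia.
have [|w [xw qw]] := @extend (i + k) x q R; first by lia.
have [||b [qb wb]] := @extend (i - j) q w; [|by lia|].
  by apply: realizedW R; lia.
exists q, x, a, b; rewrite [d q x]d_sym [d q a]d_sym.
by split; [split | split; [lia | tri x w b; lia]].
Qed.

(** The case k = 1 is separate because [no_perfect_matching] needs a sphere of radius
larger by two than the one considered. *)
Lemma isosceles i k : 0 < i -> 0 < k -> k <= i -> realized (i + k) ->
  contains_triangle d i i (2 * k).
Proof.
move=> i0 k0 ki R.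
have [k1|k2] : k = 1 \/ 1 < k by lia.
  have R2 : realized i.-1.+2 by apply: realizedW R; lia.
  have [q _] := R2.
  have [|u [qu _]] := @extend i.-1 q q (realizedW (leqW (leqnSn _)) R2).
    by rewrite d_refl.
  have [s [t [qs qt _ _ st]]] := upper_pair R2 qu.
  by exists q, s, t; split; lia.
have climb j q v s t : j <= k -> d q v = i - j -> d q s = i - j ->
    d q t = i - j -> d v s = 1 -> d v t = 1 -> d s t = 2 ->
    exists q s x, [/\ d q s = i - j, d q x = i + j & d s x = 2 * k].
  move=> jk qv qs qt vs vt st.
  have [p [x [a [b [[px pa pb] [xa xb]]]]]] := spread R ki jk.
  have ij0 : 0 < i - j.
    rewrite lt0n; apply/eqP => ij0; rewrite ij0 in qv qs.
    by move: vs; rewrite -(d_eq0 qv) -(d_eq0 qs) d_refl.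
  case Em: (i - j) ij0 qv qs qt pa pb => [//|m] _ qv qs qt pa pb.
  have Rm : realized m.+2 by apply: realizedW R; lia.
  have [|g [isog gq gv]] := @hom2 q v p a; first by lia.
  have [||||||||||c [pc xc]] := @interpolation m p (g v) (g s) (g t) x a b (2 * k) Rm;
    rewrite -?gq ?isog ?gq //.
  by exists p, c, x; rewrite [d c x]d_sym.
suff [q [s [x [qs qx sx]]]] : exists q s x,
    [/\ d q s = i - 0, d q x = i + 0 & d s x = 2 * k].
  by exists q, s, x; split; lia.
have [tr|ntr] := EM triangles.
  have R3 : realized i.-2.+3 by apply: realizedW R; lia.
  have [q [v [s [t [[qv qs qt] [vs vt st]]]]]] := level_path tr R3.
  by apply: (climb 0 q v s t); lia.
suff descent n : n <= k -> exists q s x,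
    [/\ d q s = i - (k - n), d q x = i + (k - n) & d s x = 2 * k].
  by have := descent k (leqnn k); rewrite subnn.
elim: n => [|n IHn] le_nk.
  have [x [q xq]] := R.
  have [|s [xs sq]] := @d_between x q (2 * k) (i - k); first by lia.
  exists q, s, x; rewrite subn0 [d q s]d_sym [d q x]d_sym [d s x]d_sym.
  by split.
have [q [s [x [qs qx sx]]]] := IHn (ltnW le_nk).
set j := k - n.+1 in qs qx *.
have [[p [v [a [b [[pv pa pb] [va vb ab]]]]]]|no_path] :=
    EM (exists p v a b, [/\ d p v = i - j, d p a = i - j & d p b = i - j] /\
      [/\ d v a = 1, d v b = 1 & d a b = 2]).
  by apply: (climb j p v a b) => //; lia.
have Ej : i - j = (i - (k - n)).+1 by lia.
have [|||e [qe es ex]] := @exchange_step (i - (k - n)) (i + j) q s x ntr _ qs.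
- apply: no_perfect_matching => //; first by apply: realizedW R; lia.
  move=> p v a b pv pa pb va vb.
  have [//|ab|[_ /ntr//]] := near_cases va vb.
  by case: no_path; exists p, v, a, b; rewrite Ej.
- by lia.
- by lia.
by exists e, s, x; rewrite Ej.
Qed.

End HomogeneousGeodesicSpace.

(** * The path metric of a graph *)

Section GraphMetric.

Variables (V : Type) (e : rel V).
Hypothesis e_simple : simple_graph e.
Hypothesis e_connected : connected_graph e.

Local Notation d := (gdist e).

Lemma gdist_walk x y : walk_of_length e x y (d x y).
Proof. by have [] := gdistP e_connected x y. Qed.

Lemma gdist_min x y n : walk_of_length e x y n -> d x y <= n.
Proof. by have [_] := gdistP e_connected x y; apply. Qed.

Lemma walk_cat x y z m n :
  walk_of_length e x y m -> walk_of_length e y z n ->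
  walk_of_length e x z (m + n).
Proof.
move=> [p [xp <- <-]] [r [yr <- <-]]; exists (p ++ r).
by rewrite cat_path last_cat size_cat xp.
Qed.

Lemma walk_sym x y n : walk_of_length e x y n -> walk_of_length e y x n.
Proof.
move=> [p [xp <- <-]]; exists (rev (belast x p)).
split; last by rewrite size_rev size_belast.
  rewrite rev_path; apply: sub_path xp => u v /=.
  by rewrite (proj1 e_simple).
by case: p {xp} => //= a p; rewrite rev_cons last_rcons.
Qed.

Lemma gdist_refl x : d x x = 0.
Proof. by apply/eqP; rewrite -leqn0; apply: gdist_min; exists [::]. Qed.

Lemma gdist_eq0 x y : d x y = 0 -> x = y.
Proof.
by move=> dxy; have := gdist_walk x y; rewrite dxy => -[p [_ <- /size0nil ->]].
Qed.

Lemma gdist_sym x y : d x y = d y x.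
Proof.
by apply/eqP; rewrite eqn_leq !gdist_min //; apply: walk_sym; apply: gdist_walk.
Qed.

Lemma gdist_tri x y z : d x z <= d x y + d y z.
Proof. by apply/gdist_min/walk_cat; apply: gdist_walk. Qed.

Lemma gdist_between x y a b : d x y = a + b ->
  exists z, d x z = a /\ d z y = b.
Proof.
move=> dxy; have [p [xp last_p size_p]] := gdist_walk x y.
rewrite -(cat_take_drop a p) cat_path last_cat in xp last_p.
have /andP[xz zy] := xp; set z := last x (take a p) in zy last_p.
have size_take_p : size (take a p) = a by rewrite size_takel // size_p dxy leq_addr.
have size_drop_p : size (drop a p) = b by rewrite size_drop size_p dxy addKn.
have xza : d x z <= a by apply: gdist_min; exists (take a p).
have zyb : d z y <= b by apply: gdist_min; exists (drop a p).
by exists z; have := gdist_tri x z y; lia.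
Qed.

Lemma gdist_eq1 x y : d x y = 1 <-> e x y.
Proof.
split=> [dxy|exy].
  have := gdist_walk x y; rewrite dxy => -[[|z [|? ?]] [] //=].
  by rewrite andbT => xz <-.
have le1 : d x y <= 1 by apply: gdist_min; exists [:: y]; rewrite /= exy.
have : d x y <> 0.
  by move=> /gdist_eq0 xy; rewrite xy (proj2 e_simple) in exy.
by lia.
Qed.

(** The tuples may have repetitions; the induced maps between their ranges are well
defined because distinct points are at nonzero distance. *)
Lemma gdist_hom : metrically_homogeneous e -> forall n (x y : 'I_n -> V),
  (forall i j, d (x i) (x j) = d (y i) (y j)) ->
  exists g : V -> V,
    (forall u v, d (g u) (g v) = d u v) /\ forall i, g (x i) = y i.
Proof.
move=> hom n x y dxy.
have restrict (z t : 'I_n -> V) : (forall i j, d (z i) (z j) = d (t i) (t j)) ->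
    exists f : range z -> range t, forall i a, val a = z i -> val (f a) = t i.
  move=> dzt.
  have idx (a : range z) : {i | val a = z i}.
    by have /set_mem/cid2[i _ <-] := valP a; exists i.
  exists (fun a => SigSub (mem_set (imageP t (I : setT (projT1 (idx a)))))).
  move=> i a ai /=; apply: gdist_eq0; rewrite -dzt.
  by case: (idx a) => j /= <-; rewrite ai gdist_refl.
have [f fE] := restrict x y dxy.
have [h hE] := restrict y x (fun i j => esym (dxy i j)).
have valE (z : 'I_n -> V) (a : range z) : exists i, val a = z i.
  by have /set_mem[i _ <-] := valP a; exists i.
have [|g [[_ isog] gf]] := hom (range x) (range y) f
    (finite_image _ (@finite_finset _ _)) (finite_image _ (@finite_finset _ _)).
  split.
    exists h => a; apply: val_inj; have [i ai] := valE _ a.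
      by rewrite ai; apply: hE; apply: fE.
    by rewrite ai; apply: fE; apply: hE.
  move=> a b; have [i ai] := valE _ a; have [j bj] := valE _ b.
  by rewrite /induced (fE i) // (fE j) // ai bj.
exists g; split=> // i.
have xi : range x (x i) by exists i.
by have := gf (SigSub (mem_set xi)); rewrite /= => ->; apply: fE.
Qed.

Lemma generic_common_neighbors v0 : generic_type e v0 -> forall x y, d x y = 2 ->
  exists s t, [/\ d x s = 1, d s y = 1, d x t = 1, d t y = 1 & d s t = 2].
Proof.
move=> [gen _] x y dxy; have [_ [I [subI infI indI]]] := gen x y dxy.
have [s Is] : exists s, I s.
  apply: contrapT => I0; apply: infI.
  suff -> : I = set0 by apply: finite_set0.
  by apply/seteqP; split=> // s Is; apply: I0; exists s.
have [t It ts] : exists2 t, I t & t <> s.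
  apply: contrapT => I1; apply: infI; apply: (@sub_finite_set _ _ [set s]%classic).
    by move=> t It /=; apply: contrapT => ts; apply: I1; exists t.
  exact: finite_set1.
have [/gdist_eq1 xs /gdist_eq1 ys] := subI _ Is.
have [/gdist_eq1 xt /gdist_eq1 yt] := subI _ It.
exists s, t; split=> //; rewrite 1?gdist_sym //.
have := gdist_tri t x s; rewrite [d t x]gdist_sym.
have : d t s <> 0 by move/gdist_eq0.
have : d t s <> 1 by move/gdist_eq1; apply/negP/indI.
by lia.
Qed.

(** Without such a path, being equal or adjacent would be an invariant equivalence
relation on the neighbors of v0.  It is not equality because of a triangle, and it
is not universal because some vertex has two neighbors at distance 2. *)
Lemma primitive_path v0 : metrically_homogeneous e -> generic_type e v0 ->
  contains_triangle d 1 1 1 -> (exists x y, d x y = 2) ->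
  exists v x y z, [/\ d v x = 1, d v y = 1 & d v z = 1] /\
                  [/\ d x y = 1, d y z = 1 & d x z = 2].
Proof.
move=> hom gen [a [b [c [ab ac bc]]]] [p [q pq]].
have move_to v : exists g, (forall u w, d (g u) (g w) = d u w) /\ g v = v0.
  have [|g [isog gv]] := gdist_hom hom (x := fun _ : 'I_1 => v) (y := fun _ => v0).
    by move=> _ _; rewrite !gdist_refl.
  by exists g; split=> //; apply: (gv ord0).
apply: contrapT => no_path.
pose R : rel (neighbors e v0) := fun u w => d (val u) (val w) <= 1.
have nbr (u : neighbors e v0) : d v0 (val u) = 1.
  by apply/gdist_eq1; have /set_mem := valP u.
have R_sym u w : R u w -> R w u by rewrite /R gdist_sym.
have R_trans u w t : R u w -> R w t -> R u t.
  rewrite /R => uw wt; rewrite leqNgt; apply/negP => ut1.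
  have ut : d (val u) (val t) = 2.
    by have := gdist_tri (val u) v0 (val t); rewrite [d _ v0]gdist_sym !nbr; lia.
  apply: no_path; exists v0, (val u), (val w), (val t); split=> //.
  by have := gdist_tri (val u) (val w) (val t); split; lia.
have in_nbr u : d v0 u = 1 -> u \in neighbors e v0.
  by move=> /gdist_eq1 v0u; apply: mem_set.
have [||R_eq|R_all] := (proj2 gen) R.
- move=> x y z; split=> [|xy]; first by rewrite /R gdist_refl.
  apply/idP/idP => [xz|yz]; last exact: R_trans yz.
  exact: R_trans (R_sym _ _ xy) xz.
- by move=> g [_ isog] u w; rewrite /R; have := isog u w; rewrite /induced => ->.
- have [g [isog ga]] := move_to a.
  have gb : d v0 (g b) = 1 by rewrite -ga isog.
  have gc : d v0 (g c) = 1 by rewrite -ga isog.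
  have /R_eq/(congr1 val)/= gbc :
    R (SigSub (in_nbr _ gb)) (SigSub (in_nbr _ gc)) by rewrite /R /= isog bc.
  by move: bc; rewrite -isog gbc gdist_refl.
- have [s [t [ps _ pt _ st]]] := generic_common_neighbors gen pq.
  have [g [isog gp]] := move_to p.
  have gs : d v0 (g s) = 1 by rewrite -gp isog.
  have gt : d v0 (g t) = 1 by rewrite -gp isog.
  by have := R_all (SigSub (in_nbr _ gs)) (SigSub (in_nbr _ gt));
    rewrite /R /= isog st.
Qed.

End GraphMetric.

Theorem proposition7 (V : Type) (e : rel V) (v0 : V) (delta : option nat)
    (e_simple : simple_graph e)
    (e_connected : connected_graph e)
    (e_homogeneous : metrically_homogeneous e)
    (e_generic : generic_type e v0)
    (e_diameter : has_diameter (gdist e) delta)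
    (i k : nat) (i_gt0 : 0 < i) (k_gt0 : 0 < k) (le_ki : k <= i)
    (le_ik_delta : le_diameter (i + k) delta) :
  contains_triangle (gdist e) i i (2 * k).
Proof.
have [n [le_n R]] : exists n, i + k <= n /\ realized (gdist e) n.
  case: delta e_diameter le_ik_delta => [D [_ [x [y xy]]] le_D|unb _].
    by exists D; split=> //; exists x, y.
  by have [x [y lt_xy]] := unb (i + k); exists (gdist e x y); split;
    [exact: ltnW | exists x, y].
apply: isosceles => //.
- exact: gdist_refl.
- exact: gdist_eq0.
- exact: gdist_sym.
- exact: gdist_tri.
- exact: gdist_between.
- exact: gdist_hom.
- exact: generic_common_neighbors e_generic.
- exact: primitive_path e_generic.
- by apply: realizedW le_n R; exact: gdist_between.
Qed.
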